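(* Let $\Gamma$ be a distance-regular graph of order $v$, with valency $k>2$ and diameter $d\ge2$, with a full indubitable partition corresponding to an eigenvalue $\lambda$ of $\Gamma$ with multiplicity $m$. Then one of the following holds: $\Gamma$ is bipartite and $\lambda=-k$; or $\Gamma$ is a complete $(m+1)$-partite graph and $\lambda=-v/(m+1)$; or $\Gamma$ is a distance-regular antipodal cover of a complete graph $K_{m+1}$ and $\lambda=-1$ (with $d=3$).
   Context: Graphs are finite, simple and undirected; eigenvalues of $\Gamma$ are those of its $01$-adjacency matrix. A connected graph $\Gamma$ of diameter $d$ is distance-regular if its distance-$i$ graphs $\Gamma_i$ ($1\le i\le d$; two vertices adjacent in $\Gamma_i$ iff at distance $i$ in $\Gamma$) form an association scheme, i.e. the span of $I$ and their adjacency matrices is closed under matrix multiplication. A distance-regular graph of diameter $d$ is antipodal if $\Gamma_d$ is a disjoint union of cliques (so that being equal or at distance $d$ is an equivalence relation). A distance-regular antipodal cover of $K_{m+1}$ is an antipodal distance-regular graph of diameter $3$ with $m+1$ antipodal classes, in which the edges between any two distinct antipodal classes form a perfect matching between them. A partition $\Pi$ of the vertex set of a connected graph $\Gamma$ (into nonempty cells) is indubitable with parameters $(a,b)$ if for each cell $\mathcal{P}\in\Pi$ and each vertex $x$, the number of neighbors of $x$ in $\mathcal{P}$ equals $a$ if $x\in\mathcal{P}$, and equals $b$ otherwise. An indubitable partition with $r+1\ge2$ cells corresponds to the eigenvalue $\lambda=a-b$ of $\Gamma$; it is full (corresponding to $\lambda$) if $r$ equals the multiplicity $m$ of $\lambda$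 as an eigenvalue of $\Gamma$. *)

(* Defs.v *)
From mathcomp Require Import all_boot all_order all_algebra.

Set Implicit Arguments.
Unset Strict Implicit.
Unset Printing Implicit Defensive.

Import GRing.Theory.
Local Open Scope ring_scope.

(* A finite simple undirected graph is a symmetric irreflexive relation e on a
   finite type T of vertices; both properties are hypotheses where needed. *)

Section Graphs.
Variables (T : finType) (e : rel T).

Definition connected : Prop := forall x y : T, connect e x y.

Definition nbhd (x : T) : {set T} := [set y | e x y].

Definition regular (k : nat) : Prop := forall x : T, #|nbhd x| = k.

Definition walk (n : nat) (x y : T) : bool :=
  [exists p : n.-tuple T, path e x p && (last x p == y)].

(* Least length of a walk from x to y. A shortest walk has fewer than #|T|
   edges, so the search range suffices; the value is #|T| if there is none. *)
Definition gdist (x y : T) : nat :=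
  find (fun n => walk n x y) (iota 0 #|T|).

Definition diameter : nat := (\max_(x : T) \max_(y : T) gdist x y)%N.

Definition dist_graph (i : nat) : rel T := fun x y => gdist x y == i.

Definition bipartite : Prop :=
  exists A : {set T}, forall x y, e x y -> (x \in A) != (y \in A).

Definition complete_multipartite (n : nat) : Prop :=
  exists P : {set {set T}},
    [/\ partition P [set: T], #|P| = n
      & forall x y, e x y = (pblock P x != pblock P y)].

Definition cliques_of (P : {set {set T}}) (f : rel T) : Prop :=
  partition P [set: T] /\
  forall x y, f x y = (x != y) && (pblock P x == pblock P y).

Definition perfect_matching_between (B C : {set T}) : Prop :=
  (forall x, x \in B -> #|nbhd x :&: C| = 1%N) /\
  (forall y, y \in C -> #|nbhd y :&: B| = 1%N).

Definition indubitable (a b : nat) (P : {set {set T}}) : Prop :=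
  partition P [set: T] /\
  forall (C : {set T}) (x : T), C \in P ->
    #|nbhd x :&: C| = if x \in C then a else b.

End Graphs.

Section Spectrum.
Variable R : rcfType.

(* The vertices are numbered by the canonical enumeration of T. *)
Definition adjmx (T : finType) (f : rel T) : 'M[R]_#|T| :=
  \matrix_(i, j) (f (enum_val i) (enum_val j))%:R.

Variables (T : finType) (e : rel T).

Definition graph_eigenvalue (lambda : R) : bool :=
  eigenvalue (adjmx e) lambda.

Definition multiplicity (lambda : R) : nat :=
  \rank (eigenspace (adjmx e) lambda).

Definition distance_matrices : seq 'M[R]_#|T| :=
  1%:M :: [seq adjmx (dist_graph e i) | i <- iota 1 (diameter e)].

Definition distance_regular : Prop :=
  connected e /\
  forall M N : 'M[R]_#|T|,
    M \in <<distance_matrices>>%VS -> N \in <<distance_matrices>>%VS ->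
    M *m N \in <<distance_matrices>>%VS.

Definition full_indubitable (P : {set {set T}}) (lambda : R) : Prop :=
  exists a b : nat,
    [/\ indubitable e a b P, (2 <= #|P|)%N, lambda = a%:R - b%:R
      & #|P| = (multiplicity lambda).+1].

Definition antipodal_cover_of_complete (n : nat) : Prop :=
  [/\ distance_regular, diameter e = 3%N
    & exists P : {set {set T}},
        [/\ cliques_of P (dist_graph e (diameter e)), #|P| = n
          & forall B C, B \in P -> C \in P -> B != C ->
              perfect_matching_between e B C]].

End Spectrum.

Arguments distance_regular R {T} e.
Arguments antipodal_cover_of_complete R {T} e n.

(* Main.v *)
Require Import Defs.
From mathcomp Require Import all_boot all_order all_algebra zify.

Set Implicit Arguments.
Unset Strict Implicit.
Unset Printing Implicit Defensive.

Import GRing.Theory Num.Theory.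

(** The projector E onto the lambda-eigenspace is a polynomial in the adjacency
matrix, because a symmetric real matrix has a squarefree minimal polynomial;
hence E lies in the Bose-Mesner algebra and E_xy depends only on d(x, y). The
cell indicators of a full indubitable partition span a space containing the
eigenspace, so E_xy also depends only on the cells of x and y, and it separates
equal cells from distinct ones. Thus whether x and y share a cell is a function
of d(x, y). Adjacent vertices lie in distinct cells by connectedness. If
vertices at distance 2 share a cell, then either there are two cells, and the
graph is bipartite, or the diameter is 2 and the graph is complete multipartite.
If not, two neighbours of a vertex never share a cell, so b = 1 and the graph
covers a complete graph; vertices at distance 3 then share a cell, and a
comparison of common neighbours along a geodesic of length 4 gives d = 3. *)

(** * Distances in a connected graph *)

Section Distance.
Variables (T : finType) (e : rel T).
Hypothesis e_sym : symmetric e.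
Hypothesis e_conn : connected e.

Lemma walkP n x y :
  reflect (exists p, [/\ size p = n, path e x p & last x p = y])
          (walk e n x y).
Proof.
apply: (iffP existsP) => [[p /andP[ep /eqP lp]]|[p [<- ep lp]]].
  by exists p; rewrite size_tuple.
by exists (in_tuple p); rewrite /= ep lp eqxx.
Qed.

(** A walk without repeated vertices has fewer than [#|T|] edges, so the default value of [find]
    never occurs. *)
Lemma gdist_lt_card x y : gdist e x y < #|T|.
Proof.
rewrite /gdist -[X in _ < X](size_iota 0) -has_find.
have /connectP[p ep ->] := e_conn x y.
case/shortenP: ep => q eq Uq _; apply/hasP; exists (size q).
  by rewrite mem_iota /= -[(size q).+1]/(size (x :: q)) -(card_uniqP Uq) max_card.
by apply/walkP; exists q.
Qed.

Lemma walk_gdist x y : walk e (gdist e x y) x y.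
Proof.
have lt_d := gdist_lt_card x y.
have has_w : has (fun n => walk e n x y) (iota 0 #|T|).
  by rewrite has_find size_iota.
by have := nth_find 0 has_w; rewrite -/(gdist e x y) nth_iota.
Qed.

Lemma gdist_le_walk n x y : walk e n x y -> gdist e x y <= n.
Proof.
move=> wn; rewrite leqNgt; apply/negP => lt_nd.
have := before_find 0 lt_nd.
by rewrite nth_iota ?add0n ?wn // (ltn_trans lt_nd) ?gdist_lt_card.
Qed.

Lemma gdistxx x : gdist e x x = 0.
Proof. by apply/eqP; rewrite -leqn0 gdist_le_walk //; apply/walkP; exists [::]. Qed.

Lemma gdist_eq0 x y : (gdist e x y == 0) = (x == y).
Proof.
apply/eqP/eqP => [d0|->]; last exact: gdistxx.
by have := walk_gdist x y; rewrite d0 => /walkP[p [/size0nil-> _]].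
Qed.

Lemma gdist_triangle y x z : gdist e x z <= gdist e x y + gdist e y z.
Proof.
have /walkP[p [<- ep lp]] := walk_gdist x y.
have /walkP[q [<- eq lq]] := walk_gdist y z.
apply/gdist_le_walk/walkP; exists (p ++ q).
by rewrite size_cat cat_path last_cat lp ep eq lq.
Qed.

Lemma gdist_edge x y : e x y -> gdist e x y <= 1.
Proof.
by move=> exy; apply/gdist_le_walk/walkP; exists [:: y]; rewrite /= exy.
Qed.

Lemma gdist_eq1 x y : irreflexive e -> (gdist e x y == 1) = e x y.
Proof.
move=> e_irr; apply/eqP/idP => [d1|exy].
  have := walk_gdist x y; rewrite d1 => /walkP[[|z [|? ?]] [] //= _].
  by rewrite andbT => + <-.
apply/eqP; rewrite eqn_leq gdist_edge // lt0n gdist_eq0.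
by apply: contraTneq exy => ->; rewrite e_irr.
Qed.

Lemma gdist_sym x y : gdist e x y = gdist e y x.
Proof.
suffices le_d u v : gdist e u v <= gdist e v u.
  by apply/eqP; rewrite eqn_leq !le_d.
have /walkP[p [<- ep lp]] := walk_gdist v u.
apply/gdist_le_walk/walkP; exists (rev (belast v p)).
rewrite size_rev size_belast -lp rev_path; split=> //.
  by rewrite (eq_path (e' := e)) // => a b; rewrite e_sym.
by case: p {ep lp} => //= a p; rewrite rev_cons last_rcons.
Qed.

(** Cut a shortest walk after [i] steps; the triangle inequality turns both upper bounds into
    equalities. *)
Lemma gdist_split i j x y : gdist e x y = i + j ->
  exists2 z, gdist e x z = i & gdist e z y = j.
Proof.
move=> dxy; have := walk_gdist x y; rewrite dxy => /walkP[p [sp]].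
rewrite -(cat_take_drop i p) cat_path last_cat; set z := last x _.
case/andP=> ep eq lq.
have le_xz : gdist e x z <= i.
  apply/gdist_le_walk/walkP; exists (take i p); split=> //.
  by rewrite size_takel // sp leq_addr.
have le_zy : gdist e z y <= j.
  apply/gdist_le_walk/walkP; exists (drop i p); split=> //.
  by rewrite size_drop sp addKn.
have := gdist_triangle z x y; rewrite dxy => le_ij.
exists z; apply/eqP; rewrite eqn_leq ?le_xz ?le_zy /=.
  by rewrite -(leq_add2r j) (leq_trans le_ij) ?leq_add2l.
by rewrite -(leq_add2l i) (leq_trans le_ij) ?leq_add2r.
Qed.

Lemma gdist_le_diameter x y : gdist e x y <= diameter e.
Proof.
by apply: leq_trans (leq_bigmax x); apply: (leq_bigmax (F := gdist e x)).
Qed.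

Lemma diameter_le n : (forall x y, gdist e x y <= n) -> diameter e <= n.
Proof. by move=> le_n; apply/bigmax_leqP=> x _; apply/bigmax_leqP. Qed.

Lemma exists_gdist n : 0 < n <= diameter e -> exists x y, gdist e x y = n.
Proof.
case/andP=> n_gt0 le_nd; case: (boolP [exists x, exists y, n <= gdist e x y]).
  case/existsP=> x /existsP[y le_n]; exists x.
  by have [z dxz _] := gdist_split (esym (subnKC le_n)); exists z.
move/existsPn=> lt_n; suff : diameter e <= n.-1 by rewrite leqNgt prednK ?le_nd.
apply: diameter_le => x y; rewrite -ltnS prednK // ltnNge.
by have /existsPn := lt_n x; apply.
Qed.
End Distance.

(** * Partitions whose cells are determined by the distance *)

Lemma notin_pair (U : finType) (A : {pred U}) u v :
  2 < #|A| -> exists w, [/\ w \in A, w != u & w != v].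
Proof.
move=> A_gt2; have /subsetPn[w Aw] : ~~ (A \subset [set u; v]).
  apply: contraL A_gt2 => /subset_leq_card; rewrite cards2 -leqNgt => /leq_trans.
  by apply; case: (u != v).
by rewrite !inE negb_or => /andP[]; exists w.
Qed.

Section Cells.
Variables (T : finType) (P : {set {set T}}).
Hypothesis partP : partition P [set: T].

Lemma mem_pblockT x : x \in pblock P x.
Proof. by rewrite mem_pblock (cover_partition partP). Qed.

Lemma pblock_cell x : pblock P x \in P.
Proof. by rewrite pblock_mem // (cover_partition partP). Qed.

Lemma pblockE C x : C \in P -> (x \in C) = (pblock P x == C).
Proof.
have /and3P[_ tP _] := partP => PC.
by apply/idP/eqP => [|<-]; [exact: def_pblock | exact: mem_pblockT].
Qed.

Lemma cell_neq0 C : C \in P -> exists x, x \in C.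
Proof.
move=> PC; apply/set0Pn; have /and3P[_ _] := partP.
by apply: contraNneq => <-.
Qed.

End Cells.

Section DistanceCells.
Variables (T : finType) (e : rel T) (P : {set {set T}}) (a b : nat).
Hypotheses (e_sym : symmetric e) (e_irr : irreflexive e).
Hypothesis e_conn : connected e.
Hypothesis P_ind : indubitable e a b P.
Hypothesis P_gt1 : 1 < #|P|.
Hypothesis cell_gdist : forall x y x' y', gdist e x y = gdist e x' y' ->
  (pblock P x == pblock P y) = (pblock P x' == pblock P y').
Let partP : partition P [set: T] := P_ind.1.

(** One edge inside a cell would put every edge inside a cell, all edges being at distance 1;
    connectedness would then leave a single cell. *)
Lemma edge_cells_neq x y : e x y -> pblock P x != pblock P y.
Proof.
move=> exy; apply/negP => same_xy.
have same_e u v : e u v -> pblock P u = pblock P v.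
  move=> euv; apply/eqP; rewrite (cell_gdist (x' := x) (y' := y)) //.
  by transitivity 1; [|symmetry]; apply/eqP; rewrite gdist_eq1.
have same u v : pblock P u = pblock P v.
  have /connectP[p + ->] := e_conn u v.
  by elim: p u => //= w p IHp u /andP[/same_e-> /IHp].
have /card_gt1P[C [D [PC PD]]] := P_gt1.
have [[u Cu] [w Dw]] := (cell_neq0 partP PC, cell_neq0 partP PD).
move: Cu Dw; rewrite !(pblockE partP) // => /eqP<- /eqP<-.
by rewrite (same u w) eqxx.
Qed.

Lemma inner_degree0 (x : T) : a = 0.
Proof.
have := P_ind.2 _ x (pblock_cell partP x); rewrite (mem_pblockT partP) => <-.
apply/eqP; rewrite cards_eq0; apply/eqP/setP => y; rewrite !inE.
apply/negP => /andP[/edge_cells_neq + yx].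
by move: yx; rewrite (pblockE partP) ?(pblock_cell partP) // eq_sym => ->.
Qed.

Lemma outer_degree_gt0 x y : e x y -> 0 < b.
Proof.
move=> exy; have := P_ind.2 _ x (pblock_cell partP y).
rewrite (pblockE partP) ?(pblock_cell partP) // (negPf (edge_cells_neq exy)).
by move=> <-; apply/card_gt0P; exists y; rewrite !inE exy (mem_pblockT partP).
Qed.

Lemma nbr_in_cell x C : 0 < b -> C \in P -> x \notin C ->
  exists2 y, e x y & pblock P y = C.
Proof.
move=> b_gt0 PC nCx; have := P_ind.2 _ x PC; rewrite (negPf nCx) => bE.
have /card_gt0P[y] : 0 < #|nbhd e x :&: C| by rewrite bE.
by rewrite !inE (pblockE partP) // => /andP[exy /eqP]; exists y.
Qed.

Lemma gdist_le2 y x z : e x y -> e y z -> gdist e x z <= 2.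
Proof.
move=> exy eyz; apply: leq_trans (gdist_triangle e_conn y x z) _.
by rewrite -[2]/(1 + 1) leq_add ?gdist_edge.
Qed.

Lemma gdist1_edge x y : gdist e x y = 1 -> e x y.
Proof. by move/eqP; rewrite gdist_eq1. Qed.

Lemma gdist_small x y : gdist e x y <= 2 ->
  [\/ x = y, e x y | gdist e x y = 2].
Proof.
case dE: (gdist e x y) => [|[|[|//]]] _.
- by apply: Or31; apply/eqP; rewrite -(gdist_eq0 e_conn) dE.
- by apply: Or32; apply: gdist1_edge.
- exact: Or33.
Qed.

Lemma bipartite_of_two_cells k : #|P| = 2 -> regular e k ->
  bipartite e /\ k = b.
Proof.
move=> P2 e_val; have /card_gt1P[C [D [PC PD nCD]]] := P_gt1.
have P_CD x : (pblock P x == C) || (pblock P x == D).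
  have /eqP PE : [set C; D] == P.
    by rewrite eqEcard P2 cards2 nCD andbT; apply/subsetP=> ? /set2P[]->.
  by have := pblock_cell partP x; rewrite -PE !inE.
split.
  exists C => x y /edge_cells_neq; rewrite !(pblockE partP) //.
  case/orP: (P_CD x) => /eqP->; case/orP: (P_CD y) => /eqP->; rewrite ?eqxx //.
    by rewrite eq_sym => /negPf->.
  by move/negPf->.
have [x Cx] := cell_neq0 partP PC.
have := P_ind.2 _ x PD; rewrite (pblockE partP) //.
move: Cx; rewrite (pblockE partP) // => /eqP xC; rewrite xC (negPf nCD) => <-.
rewrite -(e_val x); congr #|pred_of_set _|; apply/esym/setIidPl/subsetP=> y.
rewrite inE => /edge_cells_neq; rewrite xC (pblockE partP) //.
by case/orP: (P_CD y) => /eqP->; rewrite ?eqxx.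
Qed.

(** * Vertices at distance 2 in a common cell *)

Section Distance2Same.
Hypothesis same2 : forall x y, gdist e x y = 2 -> pblock P x = pblock P y.

Lemma gdist2_cells_neq_edge x y :
  gdist e x y <= 2 -> pblock P x != pblock P y -> e x y.
Proof.
by case/gdist_small=> [->|//|/same2->]; rewrite eqxx.
Qed.

(** On a geodesic [x y1 y2 z] the cells alternate. A neighbour [w] of [y2] in a third cell is
    adjacent to [y1] and [z], and then to [x], so that [x w z] is too short. *)
Lemma gdist_le2_of_three_cells x y : 0 < b -> 2 < #|P| -> gdist e x y <= 2.
Proof.
move=> b_gt0 P_gt2; rewrite leqNgt; apply/negP=> d_gt2.
have [z dxz _] := gdist_split e_conn (esym (subnKC d_gt2)).
have [y2 dxy2 /gdist1_edge ey2z] := gdist_split e_conn (dxz : _ = 2 + 1).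
have [y1 /gdist1_edge exy1 /gdist1_edge ey1y2] :=
  gdist_split e_conn (dxy2 : _ = 1 + 1).
have zy1 : pblock P y1 = pblock P z.
  apply: same2; apply/eqP; rewrite eqn_leq (gdist_le2 ey1y2 ey2z).
  have := gdist_triangle e_conn y1 x z; rewrite dxz.
  by have := gdist_edge e_conn exy1; lia.
have [C [PC nCx nCy1]] := notin_pair (pblock P x) (pblock P y1) P_gt2.
have [w ey2w wC] : exists2 w, e y2 w & pblock P w = C.
  by apply: nbr_in_cell; rewrite // (pblockE partP) // -(same2 dxy2) eq_sym.
have ewy1 : e w y1.
  apply: gdist2_cells_neq_edge; last by rewrite wC.
  by apply: (gdist_le2 (y := y2)); rewrite e_sym.
have ewz : e w z.
  apply: gdist2_cells_neq_edge; last by rewrite wC -zy1.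
  by apply: (gdist_le2 (y := y2)); rewrite // e_sym.
have exw : e x w.
  apply: gdist2_cells_neq_edge; last by rewrite wC eq_sym.
  by apply: (gdist_le2 exy1); rewrite e_sym.
by have := gdist_le2 exw ewz; rewrite dxz.
Qed.

(** Each cell has [b] vertices, since a vertex outside it is adjacent to all of it. The count of
    vertices later rewrites the eigenvalue [- b]. *)
Lemma complete_multipartite_of_gdist_le2 :
  (forall x y, gdist e x y <= 2) ->
  complete_multipartite e #|P| /\ #|T| = #|P| * b.
Proof.
move=> d_le2; have eE x y : e x y = (pblock P x != pblock P y).
  by apply/idP/idP => [/edge_cells_neq|/gdist2_cells_neq_edge->].
split; first by exists P.
rewrite -cardsT; apply: card_uniform_partition partP => C PC.
have [D PD nDC] : exists2 D, D \in P & D != C.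
  have /card_gt1P[C1 [C2 [PC1 PC2 nC12]]] := P_gt1.
  by case: (eqVneq C1 C) nC12 => [->|]; [exists C2; rewrite 1?eq_sym | exists C1].
have [x] := cell_neq0 partP PD; rewrite (pblockE partP) // => /eqP xD.
have := P_ind.2 _ x PC; rewrite (pblockE partP) // xD (negPf nDC) => <-.
congr #|pred_of_set _|; apply/esym/setIidPr/subsetP=> y.
by rewrite inE eE (pblockE partP) // => /eqP->; rewrite xD.
Qed.
End Distance2Same.

(** * Vertices at distance 2 in distinct cells *)

Section Distance2Diff.
Hypothesis diff2 : forall x y, gdist e x y = 2 -> pblock P x != pblock P y.

(** Two neighbours of a vertex are at distance at most 2, and neither distance 1 nor distance 2
    occurs inside a cell. *)
Lemma nbr_cell_inj x y z :
  e x y -> e x z -> pblock P y = pblock P z -> y = z.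
Proof.
move=> exy exz yz; have : gdist e y z <= 2 by apply: (gdist_le2 _ exz); rewrite e_sym.
by case/gdist_small=> // [/edge_cells_neq|/diff2]; rewrite yz eqxx.
Qed.

Lemma same_cell_gdist3 x y : pblock P x = pblock P y -> x != y ->
  gdist e x y <= 3 -> gdist e x y = 3.
Proof.
move=> xy nxy d_le3; apply/eqP; rewrite eqn_leq d_le3 ltnNge.
apply/negP=> /gdist_small[xyE|/edge_cells_neq|/diff2]; rewrite ?xy ?eqxx //.
by rewrite xyE eqxx in nxy.
Qed.

(** Take for [z] a neighbour of [x] in the cell of [y]. This one pair will show that all pairs at
    distance 3 share a cell and that the diameter is at least 3. *)
Lemma exists_same_cell_gdist3 x y : gdist e x y = 2 ->
  exists2 z, gdist e z y = 3 & pblock P z = pblock P y.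
Proof.
move=> dxy; have b_gt0 : 0 < b.
  have [z /gdist1_edge exz _] := gdist_split e_conn (dxy : _ = 1 + 1).
  exact: outer_degree_gt0 exz.
have [z exz zy] : exists2 z, e x z & pblock P z = pblock P y.
  apply: nbr_in_cell; rewrite ?(pblock_cell partP) //.
  by rewrite (pblockE partP) ?(pblock_cell partP) ?diff2.
exists z => //; apply: same_cell_gdist3 => //.
  by apply/eqP=> zyE; move: (gdist_edge e_conn exz); rewrite zyE dxy.
rewrite e_sym in exz; have := gdist_triangle e_conn x z y.
by have := gdist_edge e_conn exz; lia.
Qed.

Lemma outer_degree1 x y : e x y -> b = 1.
Proof.
move=> exy; apply/eqP; rewrite eqn_leq (outer_degree_gt0 exy) andbT.
have := P_ind.2 _ x (pblock_cell partP y).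
rewrite (pblockE partP) ?(pblock_cell partP) // (negPf (edge_cells_neq exy)).
move=> <-; apply/card_le1_eqP => u w.
rewrite !inE !(pblockE partP) ?(pblock_cell partP) //.
by move=> /andP[exu /eqP uy] /andP[exw /eqP wy]; apply: (nbr_cell_inj exw exu); rewrite uy.
Qed.

(* On a geodesic x0 x1 x2 x3 x4 every other neighbour of x2 is adjacent to both
   x1 and x3, so c_2 >= 2; but a second common neighbour of x0 and x2 would
   then be adjacent to x3. *)
Lemma gdist_neq4 k x0 x4 : regular e k -> 2 < k ->
  (forall x y, gdist e x y = 3 -> pblock P x = pblock P y) ->
  (forall x y x' y', gdist e x y = 2 -> gdist e x' y' = 2 ->
     #|nbhd e x :&: nbhd e y| = #|nbhd e x' :&: nbhd e y'|) ->
  gdist e x0 x4 <> 4.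
Proof.
move=> e_val k_gt2 same3 c2_const d04.
have tri := gdist_triangle e_conn.
have [x2 d02 d24] := gdist_split e_conn (d04 : _ = 2 + 2).
have [x1 d01 d12] := gdist_split e_conn (d02 : _ = 1 + 1).
have [x3 d23 d34] := gdist_split e_conn (d24 : _ = 1 + 1).
have d03 : gdist e x0 x3 = 3 by move: (tri x3 x0 x4) (tri x2 x0 x3); lia.
have d14 : gdist e x1 x4 = 3 by move: (tri x1 x0 x4) (tri x2 x1 x4); lia.
have d13 : gdist e x1 x3 = 2 by move: (tri x1 x0 x3) (tri x2 x1 x3); lia.
have [e01 e12 e23 e34] := And4 (gdist1_edge d01) (gdist1_edge d12)
  (gdist1_edge d23) (gdist1_edge d34).
have nbr2 w : e x2 w -> w != x1 -> w != x3 -> e w x1 /\ e w x3.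
  move=> e2w nw1 nw3; have dw2 := gdist_edge e_conn e2w.
  have nw1c : pblock P w != pblock P x1.
    by apply: contra_neq nw1; apply: (nbr_cell_inj e2w); rewrite e_sym.
  have nw3c : pblock P w != pblock P x3.
    by apply: contra_neq nw3; apply: (nbr_cell_inj e2w).
  (* Distance 3 from [x0] would put [w] in the cell of [x3], another neighbour of [x2]; the same
     holds for [x4] and [x1]. So [w] is at distance 2 from both ends. *)
  have d0w : gdist e x0 w <> 3.
    by move/same3=> c0w; move: nw3c; rewrite -c0w (same3 _ _ d03) eqxx.
  have dw4 : gdist e w x4 <> 3.
    by move/same3=> cw4; move: nw1c; rewrite cw4 (same3 _ _ d14) eqxx.
  have d2w := gdist_sym e_sym e_conn w x2.
  have d0w2 : gdist e x0 w = 2.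
    by move: (tri x2 x0 w) (tri x2 w x4) (tri w x0 x4); lia.
  have dw42 : gdist e w x4 = 2.
    by move: (tri x2 x0 w) (tri x2 w x4) (tri w x0 x4); lia.
  (* The midpoint [s] is at distance 3 from [x4], hence in the cell of [x1]; both are neighbours of
     [x0], so they coincide. Likewise [t] is [x3]. *)
  have [s d0s dsw] := gdist_split e_conn (d0w2 : _ = 1 + 1).
  have [t dwt dt4] := gdist_split e_conn (dw42 : _ = 1 + 1).
  have ds4 : gdist e s x4 = 3 by move: (tri s x0 x4) (tri w s x4); lia.
  have d0t : gdist e x0 t = 3 by move: (tri t x0 x4) (tri w x0 t); lia.
  have s1 : s = x1.
    apply: (nbr_cell_inj (gdist1_edge d0s) e01).
    by rewrite (same3 _ _ ds4) (same3 _ _ d14).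
  have t3 : t = x3.
    apply: (nbr_cell_inj (x := x4)); rewrite 1?e_sym //.
      exact: gdist1_edge.
    by rewrite -(same3 _ _ d0t) (same3 _ _ d03).
  by rewrite -s1 -t3 e_sym; split; apply: gdist1_edge.
have [w [+ nw1 nw3]] : exists w, [/\ w \in nbhd e x2, w != x1 & w != x3].
  by apply: notin_pair; rewrite e_val.
rewrite inE => e2w; have [ew1 ew3] := nbr2 w e2w nw1 nw3.
(* The vertices [x1] and [x3] have the common neighbours [x2] and [w]; constancy of the count
   carries this over to [x0] and [x2]. *)
have c2_gt1 : 1 < #|nbhd e x0 :&: nbhd e x2|.
  rewrite (c2_const _ _ _ _ d02 d13); apply/card_gt1P; exists x2, w.
  rewrite !inE e12 (e_sym x3 x2) e23 (e_sym x1) ew1 (e_sym x3) ew3; split=> //.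
  by apply: contraTneq e2w => <-; rewrite e_irr.
have [s [+ ns1]] : exists s, s \in nbhd e x0 :&: nbhd e x2 /\ s != x1.
  have /card_gt1P[s [t [s02 t02 nst]]] := c2_gt1.
  by case: (eqVneq s x1) nst => [->|]; [exists t; rewrite eq_sym | exists s].
rewrite !inE => /andP[e0s e2s].
have ns3 : s != x3.
  by apply/eqP=> s3; move: (gdist_edge e_conn e0s); rewrite s3 d03.
by have [_ es3] := nbr2 s e2s ns1 ns3; move: (gdist_le2 e0s es3); rewrite d03.
Qed.
End Distance2Diff.

End DistanceCells.

Local Open Scope ring_scope.

(** * Spectral projectors and the Bose-Mesner algebra *)

(** By symmetry the diagonal entries of the square are the sums of squares of the rows. *)
Lemma sym_mx_sqr_eq0 (R : realDomainType) n (B : 'M[R]_n) :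
  B^T = B -> B *m B = 0 -> B = 0.
Proof.
move=> symB BB0; apply/matrixP=> i j; rewrite mxE.
have /eqP : (B *m B) i i = 0 by rewrite BB0 mxE.
rewrite mxE psumr_eq0 => [|l _]; last first.
  by rewrite -{2}symB mxE -expr2 sqr_ge0.
move/allP/(_ j (mem_index_enum _)); rewrite /= -{2}symB mxE -expr2 sqrf_eq0.
by move/eqP.
Qed.

Lemma horner_mx_in_vspace (F : fieldType) n (A : 'M[F]_n.+1)
    (S : {vspace 'M[F]_n.+1}) (p : {poly F}) :
  1%:M \in S -> A \in S ->
  (forall M N, M \in S -> N \in S -> M *m N \in S) -> horner_mx A p \in S.
Proof.
move=> S1 SA SM; elim/poly_ind: p => [|p c IHp]; first by rewrite rmorph0 mem0v.
rewrite rmorphD rmorphM /= horner_mx_X horner_mx_C memvD ?SM //.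
by rewrite -scalemx1 memvZ.
Qed.

(** The projector is [q(A) / q(lambda)], where [q] is the minimal polynomial of [A] divided by
    ['X - lambda%:P]. *)
Lemma spectral_projector_in_vspace (R : rcfType) n (A : 'M[R]_n)
    (S : {vspace 'M[R]_n}) (lambda : R) :
  1%:M \in S -> A \in S ->
  (forall M N, M \in S -> N \in S -> M *m N \in S) ->
  (forall M, M \in S -> M^T = M) -> eigenvalue A lambda ->
  exists E, [/\ E \in S, E *m A = lambda *: E
    & forall u : 'rV_n, u *m A = lambda *: u -> u *m E = u].
Proof.
(* Polynomials are evaluated in a matrix ring of positive size; in size 0 there is no
   eigenvector. *)
case: n A S => [|n] A S S1 SA SM Ssym.
  by case/eigenvalueP=> u _; rewrite [u]thinmx0 eqxx.
rewrite eigenvalue_root_min => /factor_theorem[q Dp].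
have SH p : horner_mx A p \in S by apply: horner_mx_in_vspace.
have Xl : horner_mx A ('X - lambda%:P) = A - lambda%:M.
  by rewrite rmorphB /= horner_mx_X horner_mx_C.
have min_neq0 (r : {poly R}) c : r != 0 -> r * ('X - c%:P) = mxminpoly A ->
    horner_mx A r != 0.
  move=> r0 Dr; apply/eqP => /mxminpoly_min/dvdp_leq-/(_ r0).
  by rewrite -Dr size_Mmonic ?monicXsubC // size_XsubC addn2 ltnn.
have p_neq0 : mxminpoly A != 0 by rewrite monic_neq0 ?mxminpoly_monic.
have q_neq0 : q != 0.
  by apply/eqP=> q0; move: p_neq0; rewrite Dp q0 mul0r eqxx.
(* If [lambda] were a double root, the square of [q(A)] would vanish, hence [q(A)] by symmetry,
   against minimality. *)
have ql_neq0 : q.[lambda] != 0.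
  apply/negP => /factor_theorem[r Dq].
  have := min_neq0 _ _ q_neq0 (esym Dp); apply/negP; rewrite negbK.
  apply/eqP/sym_mx_sqr_eq0; first exact: Ssym.
  rewrite -[horner_mx A q *m horner_mx A q]rmorphM /= {1}Dq mulrAC -mulrA.
  by rewrite -Dp rmorphM /= mx_root_minpoly mulr0.
exists (q.[lambda]^-1 *: horner_mx A q); split.
- exact: memvZ.
- rewrite -scalemxAl scalerA mulrC -scalerA; congr (_ *: _).
  apply/eqP; rewrite -subr_eq0 -mul_mx_scalar -mulmxBr -Xl.
  by rewrite -[_ *m _]rmorphM /= -Dp mx_root_minpoly.
move=> u uA; have uH p : u *m horner_mx A p = p.[lambda] *: u.
  elim/poly_ind: p => [|p c IHp]; first by rewrite rmorph0 horner0 mulmx0 scale0r.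
  rewrite rmorphD rmorphM /= horner_mx_X horner_mx_C mulmxDr mulmxA IHp.
  by rewrite -scalemxAl uA mul_mx_scalar hornerMXaddC scalerA scalerDl.
by rewrite -scalemxAr uH scalerA mulVf ?scale1r.
Qed.

Section BoseMesner.
Variables (R : rcfType) (T : finType) (e : rel T).
Hypotheses (e_sym : symmetric e) (e_irr : irreflexive e).
Hypothesis e_dr : distance_regular R e.
Let e_conn : connected e := e_dr.1.
Local Notation A := (adjmx R e).
Local Notation S := <<distance_matrices R e>>%VS.

Lemma mulmx_adj (n : nat) (M : 'M[R]_(n, #|T|)) i (y : T) :
  (M *m A) i (enum_rank y) = \sum_(x | e x y) M i (enum_rank x).
Proof.
rewrite mxE (reindex_onto enum_rank enum_val) => [|j _]; last exact: enum_valK.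
rewrite [RHS]big_mkcond /=; apply: eq_big => [x|x _]; first by rewrite enum_rankK eqxx.
by rewrite mxE !enum_rankK; case: e; rewrite ?mulr1 ?mulr0.
Qed.

Lemma distance_span_const M x y x' y' :
  M \in S -> gdist e x y = gdist e x' y' ->
  M (enum_rank x) (enum_rank y) = M (enum_rank x') (enum_rank y').
Proof.
move=> /(coord_span (X := in_tuple _))-> eq_d; rewrite !summxE; apply: eq_bigr => i _.
rewrite !mxE; congr (_ * _).
have /= := mem_nth 0 (ltn_ord i); rewrite inE => /orP[/eqP->|/mapP[j _ ->]].
  by rewrite !mxE !(inj_eq enum_rank_inj) -!(gdist_eq0 e_conn) eq_d.
by rewrite !mxE !enum_rankK /dist_graph eq_d.
Qed.

Lemma distance_span_sym M : M \in S -> M^T = M.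
Proof.
move=> SM; apply/matrixP => i j; rewrite mxE -(enum_valK i) -(enum_valK j).
by apply: distance_span_const; rewrite // gdist_sym.
Qed.

Lemma scalar1_in_distance_span : 1%:M \in S.
Proof. by rewrite memv_span // mem_head. Qed.

Lemma adjmx_in_distance_span : (0 < diameter e)%N -> A \in S.
Proof.
move=> d_gt0; have -> : A = adjmx R (dist_graph e 1).
  by apply/matrixP=> i j; rewrite !mxE /dist_graph gdist_eq1.
by rewrite memv_span // inE map_f ?orbT // mem_iota add1n ltnS.
Qed.

(** The entries of [A *m A] count common neighbours, and this product stays in the Bose-Mesner
    algebra. *)
Lemma card_common_nbhd_gdist x y x' y' :
  (0 < diameter e)%N -> gdist e x y = gdist e x' y' ->
  #|nbhd e x :&: nbhd e y| = #|nbhd e x' :&: nbhd e y'|.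
Proof.
move=> d_gt0 eq_d; have SA := adjmx_in_distance_span d_gt0.
have AA u v : (A *m A) (enum_rank u) (enum_rank v) = #|nbhd e u :&: nbhd e v|%:R.
  rewrite mulmx_adj -sum1_card natr_sum big_mkcond [RHS]big_mkcond; apply: eq_bigr => z _.
  by rewrite !inE mxE !enum_rankK (e_sym z); do 2!case: e.
apply/eqP; rewrite -(eqr_nat R) -!AA; apply/eqP.
by apply: distance_span_const eq_d; apply: e_dr.2.
Qed.

(** * The eigenspace of a full indubitable partition *)

Variables (lambda : R) (P : {set {set T}}) (a b : nat).
Hypothesis d_gt0 : (0 < diameter e)%N.
Hypothesis eig : graph_eigenvalue e lambda.
Hypothesis P_ind : indubitable e a b P.
Hypothesis lambda_ab : lambda = a%:R - b%:R.
Hypothesis P_full : #|P| = (multiplicity e lambda).+1.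
Let partP : partition P [set: T] := P_ind.1.

Let K : 'M[R]_(#|P|, #|T|) := \matrix_(i < #|P|, j < #|T|) (enum_val j \in enum_val i)%:R.

(** One representative per cell yields a right inverse, the cells being disjoint. *)
Lemma cell_mx_row_free : row_free K.
Proof.
have repC (i : 'I_#|P|) : {x | x \in enum_val i}.
  by apply: sigW; apply: (cell_neq0 partP); apply: enum_valP.
apply/row_freeP; exists (\matrix_(j, i) (enum_val j == sval (repC i))%:R).
apply/matrixP=> i j; rewrite !mxE (bigD1 (enum_rank (sval (repC j)))) //= big1.
  rewrite !mxE !enum_rankK eqxx mulr1 addr0; congr (_%:R).
  have := svalP (repC j); rewrite !(pblockE partP) ?enum_valP // => /eqP->.
  by rewrite (inj_eq enum_val_inj) eq_sym.
by move=> l /negPf nl; rewrite !mxE -(inj_eq enum_rank_inj) enum_valK nl mulr0.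
Qed.

(** The constant term is the same for every cell, so the difference of two cell indicators satisfies
    the eigenvector equation. *)
Lemma cell_indicator_adj C y : C \in P ->
  \sum_(x | e x y) (x \in C)%:R = lambda * (y \in C)%:R + b%:R.
Proof.
move=> PC; transitivity (#|nbhd e y :&: C|%:R : R).
  rewrite -sum1_card natr_sum big_mkcond [RHS]big_mkcond; apply: eq_bigr => x _.
  by rewrite !inE e_sym; case: e; case: (x \in C).
by rewrite P_ind.2 // lambda_ab; case: ifP; rewrite ?mulr1 ?mulr0 ?add0r ?subrK.
Qed.

(* The cell indicators span a space of dimension m + 1 which A - lambda sends
   onto a line, so its intersection with the eigenspace has dimension m. *)
Lemma eigenspace_sub_cells : (eigenspace A lambda <= K)%MS.
Proof.
set B := A - lambda%:M.
have KB : K *m B = (const_mx b%:R : 'cV_#|P|) *m (const_mx 1 : 'rV_#|T|).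
  apply/matrixP=> i j; rewrite -(enum_valK j) mulmxBr mul_mx_scalar mxE.
  rewrite mulmx_adj !mxE big_ord1 !mxE mulr1 enum_rankK.
  under eq_bigr do rewrite mxE enum_rankK.
  by rewrite cell_indicator_adj ?enum_valP // addrC addKr.
have rKB : (\rank (K *m B) <= 1)%N.
  by rewrite KB (leq_trans (mxrankM_maxl _ _)) ?rank_leq_col.
(* Rank-nullity for [K *m B]: the rank of [K] is one more than the dimension of the eigenspace
   [kermx B]. *)
have rk : (\rank (K *m B) + \rank (K :&: kermx B)%MS)%N = (\rank (kermx B)).+1.
  by rewrite mxrank_mul_ker (eqP cell_mx_row_free) P_full.
have le_r : (\rank (kermx B) <= \rank (K :&: kermx B)%MS)%N.
  by rewrite -ltnS -rk -add1n leq_add2r.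
apply: submx_trans (capmxSl K (kermx B)).
by rewrite -(geq_leqif (mxrank_leqif_sup (capmxSr K (kermx B)))).
Qed.

Lemma gdist_same_cell x y x' y' : gdist e x y = gdist e x' y' ->
  (pblock P x == pblock P y) = (pblock P x' == pblock P y').
Proof.
have [E [SE EA EW]] := spectral_projector_in_vspace scalar1_in_distance_span
  (adjmx_in_distance_span d_gt0) e_dr.2 distance_span_sym eig.
pose f u v := E (enum_rank u) (enum_rank v).
have f_gdist u v u' v' : gdist e u v = gdist e u' v' -> f u v = f u' v'.
  exact: distance_span_const.
have f_sym u v : f u v = f v u by apply: f_gdist; rewrite gdist_sym.
have f_diag u v : f u u = f v v by apply: f_gdist; rewrite !gdistxx.
have f_cell u v v' : pblock P v = pblock P v' -> f u v = f u v'.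
  (* Each row of [E] lies in the eigenspace, so it combines cell indicators and is constant on
     cells. *)
  have /submxP[D rowE] : (row (enum_rank u) E <= K)%MS.
    apply: submx_trans eigenspace_sub_cells; apply/eigenspaceP.
    by rewrite -row_mul EA; apply/rowP=> j; rewrite !mxE.
  have fE z : f u z = (D *m K) 0 (enum_rank z) by rewrite -rowE mxE.
  move=> eq_vv'; rewrite !fE !mxE; apply: eq_bigr => l _; rewrite !mxE.
  by rewrite !enum_rankK !(pblockE partP) ?enum_valP ?eq_vv'.
suffices same u v : (pblock P u == pblock P v) = (f u v == f u u).
  by move=> eq_d; rewrite !same (f_gdist _ _ _ _ eq_d) (f_diag x x').
apply/eqP/eqP => [eq_uv|fuv]; first exact/esym/f_cell.
apply: contraTeq isT => neq_uv.
(* This eigenvector is fixed by [E]. If [f u v = f u u], its image takes equal values at [u] and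
   [v], whereas [w] is 1 at [u] and -1 at [v]. *)
pose w := \row_j ((enum_val j \in pblock P u)%:R - (enum_val j \in pblock P v)%:R) : 'rV[R]_#|T|.
have wA : w *m A = lambda *: w.
  apply/rowP=> j; rewrite -(enum_valK j) mulmx_adj !mxE enum_rankK.
  under eq_bigr do rewrite mxE enum_rankK.
  rewrite sumrB !cell_indicator_adj ?(pblock_cell partP) // mulrBr opprD addrACA.
  by rewrite subrr addr0.
have : w 0 (enum_rank u) = w 0 (enum_rank v).
  rewrite -(EW w wA) !mxE; apply: eq_bigr => j _; rewrite -(enum_valK j).
  rewrite -/(f _ u) -/(f _ v) !mxE enum_rankK; set z := enum_val j.
  have [zu|nzu] := boolP (z \in pblock P u).
    move: zu; rewrite (pblockE partP) ?(pblock_cell partP) // => /eqP eq_zu.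
    rewrite (f_sym z u) (f_sym z v) (f_cell u z u eq_zu) (f_cell v z u eq_zu).
    by rewrite (f_sym v) fuv.
  have [zv|nzv] := boolP (z \in pblock P v); last by rewrite subrr !mul0r.
  move: zv; rewrite (pblockE partP) ?(pblock_cell partP) // => /eqP eq_zv.
  rewrite (f_sym z u) (f_sym z v) (f_cell u z v eq_zv) (f_cell v z v eq_zv).
  by rewrite fuv (f_diag v u).
rewrite !mxE !enum_rankK !(mem_pblockT partP) !(pblockE partP) ?(pblock_cell partP) //.
rewrite (negPf neq_uv) eq_sym (negPf neq_uv) subr0 sub0r => /eqP.
by rewrite eq_sym -subr_eq0 -opprD oppr_eq0 -(natrD _ 1 1) pnatr_eq0.
Qed.
End BoseMesner.

(** * The three cases of the classification *)

Theorem proposition4p2 (R : rcfType) (T : finType) (e : rel T)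
    (v k d m : nat) (lambda : R) (P : {set {set T}})
    (e_sym : symmetric e) (e_irr : irreflexive e)
    (e_dr : distance_regular R e)
    (e_order : #|T| = v)
    (e_val : regular e k) (k_gt2 : (2 < k)%N)
    (e_diam : diameter e = d) (d_ge2 : (2 <= d)%N)
    (lambda_eig : graph_eigenvalue e lambda)
    (lambda_mult : multiplicity e lambda = m)
    (P_full : full_indubitable e P lambda) :
  [\/ bipartite e /\ lambda = - k%:R,
      complete_multipartite e m.+1 /\ lambda = - (v%:R / m.+1%:R)
    | [/\ antipodal_cover_of_complete R e m.+1, lambda = -1 & d = 3%N]].
Proof.
have e_conn := e_dr.1; have [a [b [P_ind P_gt1 lambda_ab P_card]]] := P_full.
have d_gt0 : (0 < diameter e)%N by rewrite e_diam (ltn_trans _ d_ge2).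
have cellD x y x' y' := gdist_same_cell (x := x) (y := y) (x' := x') (y' := y')
  e_sym e_irr e_dr d_gt0 lambda_eig P_ind lambda_ab P_card.
have Pm : #|P| = m.+1 by rewrite P_card lambda_mult.
have d_range : (0 < 2 <= diameter e)%N by rewrite e_diam.
have [x [y dxy]] := exists_gdist e_conn d_range.
have [z /(gdist1_edge e_irr e_conn) exz _] := gdist_split e_conn (dxy : _ = 1 + 1)%N.
have b_gt0 : (0 < b)%N by apply: (outer_degree_gt0 e_irr e_conn P_ind P_gt1 cellD exz).
have {lambda_ab} lambda_b : lambda = - b%:R.
  by rewrite lambda_ab (inner_degree0 e_irr e_conn P_ind P_gt1 cellD x) sub0r.
(* By [cellD], this single pair at distance 2 decides the matter for all such pairs. *)
have [same_xy|diff_xy] := boolP (pblock P x == pblock P y).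
  have same2 u w : gdist e u w = 2%N -> pblock P u = pblock P w.
    by move=> duw; apply/eqP; rewrite (cellD _ _ x y) ?dxy.
  have [P_gt2|P_le2] := ltnP 2 #|P|; last first.
    have P2 : #|P| = 2%N by apply/eqP; rewrite eqn_leq P_le2.
    have [e_bip ->] := bipartite_of_two_cells e_irr e_conn P_ind P_gt1 cellD P2 e_val.
    exact: Or31.
  have d_le2 u w : (gdist e u w <= 2)%N.
    exact: (gdist_le2_of_three_cells e_sym e_irr e_conn P_ind P_gt1 same2).
  have [e_cm card_T] := complete_multipartite_of_gdist_le2 e_irr e_conn P_ind P_gt1
    cellD same2 d_le2.
  apply: Or32; rewrite -Pm; split=> //.
  by rewrite lambda_b -e_order card_T natrM mulrAC divff ?mul1r // pnatr_eq0 Pm.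
have diff2 u w : gdist e u w = 2%N -> pblock P u != pblock P w.
  by move=> duw; rewrite (cellD _ _ x y) ?dxy.
have [w dwy wy] := exists_same_cell_gdist3 e_sym e_irr e_conn P_ind P_gt1 cellD
  diff2 dxy.
have same3 s t : gdist e s t = 3%N -> pblock P s = pblock P t.
  by move=> dst; apply/eqP; rewrite (cellD _ _ w y) ?dwy ?wy.
have d_le3 s t : (gdist e s t <= 3)%N.
  rewrite leqNgt; apply/negP => d_gt3.
  (* A longer distance would give a vertex [u] at distance exactly 4 from [s]. *)
  have [u dsu _] := gdist_split e_conn (esym (subnKC d_gt3)).
  move: dsu; apply: (gdist_neq4 e_sym e_irr e_conn P_ind P_gt1 cellD diff2 e_val k_gt2 same3) => // p q p' q' dpq dpq'.
  by apply: (card_common_nbhd_gdist e_sym e_irr e_dr d_gt0); rewrite dpq dpq'.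
have d3 : diameter e = 3%N.
  apply/eqP; rewrite eqn_leq diameter_le //= -dwy; exact: gdist_le_diameter.
have b1 : b = 1%N.
  exact: (outer_degree1 e_sym e_irr e_conn P_ind P_gt1 cellD diff2 exz).
apply: Or33; split; [split=> // | by rewrite lambda_b b1 | by rewrite -e_diam].
exists P; split=> // [|B C PB PC nBC].
  split=> [|s t]; first exact: P_ind.1.
  rewrite d3 /dist_graph; apply/eqP/andP => [dst|[nst /eqP cst]].
    by rewrite (same3 _ _ dst) eqxx -(gdist_eq0 e_conn) dst.
  exact: (same_cell_gdist3 e_irr e_conn P_ind P_gt1 cellD diff2).
(* Disjointness excludes the inner degree [a], so every count between two cells is [b], which is
   1. *)
have disj s : s \in B -> s \in C -> False.
  rewrite !(pblockE P_ind.1) // => /eqP-> BC; by rewrite BC in nBC.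
by split=> s sB; rewrite P_ind.2 //; case: ifP => // sC; case: (disj s).
Qed.
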